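(* Let $\mathcal{C}$ be a pointed finitely complete category such that the full subcategory $\mathsf{M}(\mathcal{C})$ of Mal'tsev objects is closed under finite limits in $\mathcal{C}$. Let $\mathcal{M}$ be the class of those points in $\mathcal{C}$ that are pullbacks, along a split epimorphism, of some point in $\mathsf{M}(\mathcal{C})$. Then $\mathsf{M}(\mathcal{C})$ coincides with the full subcategory $\mathcal{M}(\mathcal{C})$ of $\mathcal{M}$-special objects of $\mathcal{C}$.
   Context: A pair of morphisms with common codomain $A$ is jointly strongly epimorphic if every monomorphism into $A$ through which both factor is an isomorphism. A point over $Y$ is a pair $(f\colon A\to Y,\ s\colon Y\to A)$ with $fs=1_Y$. An object $Y$ of $\mathcal{C}$ is a Mal'tsev object if the category $\mathrm{Pt}_Y(\mathcal{C})$ of points over $Y$ is unital; explicitly, if for every two points $(f\colon A\to Y,s)$ and $(g\colon C\to Y,t)$ over $Y$ the morphisms $\langle 1_A,tf\rangle\colon A\to A\times_YC$ and $\langle sg,1_C\rangle\colon C\to A\times_YC$ are jointly strongly epimorphic. $\mathsf{M}(\mathcal{C})$ is the full subcategory of Mal'tsev objects. Precisely, a point $(f\colon A\to X,\ s\colon X\to A)$ of $\mathcal{C}$ belongs to $\mathcal{M}$ iff there exist a point $(f'\colon A'\to X',\ s'\colon X'\to A')$ with $A',X'\in\mathsf{M}(\mathcal{C})$, a point $(p\colon X\to X',\ q\colon X'\to X)$ in $\mathcal{C}$, and a point $(p'\colon A\to A',\ a\colon A'\to A)$ such that $f'p'=pf$ is a pullback square, and the sections are compatible with it: $p's=s'p$,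 $fa=qf'$, $as'=sq$. For a class $\mathcal{S}$ of points, an object $X$ is $\mathcal{S}$-special if the point $(\pi_1\colon X\times X\to X,\ \langle 1_X,1_X\rangle\colon X\to X\times X)$ belongs to $\mathcal{S}$ (equivalently, if $(\pi_2,\langle 1_X,1_X\rangle)$ belongs to $\mathcal{S}$), and $\mathcal{S}(\mathcal{C})$ denotes the full subcategory of $\mathcal{S}$-special objects. *)

(* Defs.v *)
From Stdlib Require Import FinFun.

Set Implicit Arguments.
Unset Strict Implicit.
Unset Printing Implicit Defensive.

Declare Scope cat_scope.
Delimit Scope cat_scope with cat.
Open Scope cat_scope.

Reserved Notation "a ~> b" (at level 90, no associativity).
Reserved Notation "g ∘ f" (at level 40, left associativity).

Record category := Category {
  ob :> Type;
  hom : ob -> ob -> Type;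
  idm : forall a, hom a a;
  comp : forall a b c, hom b c -> hom a b -> hom a c;
  comp1m : forall a b (f : hom a b), comp (idm b) f = f;
  compm1 : forall a b (f : hom a b), comp f (idm a) = f;
  compA : forall a b c d (h : hom c d) (g : hom b c) (f : hom a b),
    comp h (comp g f) = comp (comp h g) f
}.

Arguments hom {_} _ _.
Arguments idm {_} _.

Notation "a ~> b" := (hom a b) : cat_scope.
Notation "g ∘ f" := (comp g f) : cat_scope.

Record functor (J C : category) := Functor {
  fob :> J -> C;
  fmap : forall i j : J, (i ~> j) -> (fob i ~> fob j);
  fmap1 : forall i : J, fmap (idm i) = idm (fob i);
  fmapM : forall (i j k : J) (g : j ~> k) (f : i ~> j),
    fmap (g ∘ f) = fmap g ∘ fmap f
}.

Definition finite_category (J : category) : Prop :=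
  Finite J /\ forall i j : J, Finite (i ~> j).

Definition is_cone (J C : category) (D : functor J C) (L : C)
    (pi : forall j, L ~> D j) : Prop :=
  forall (i j : J) (f : i ~> j), fmap D f ∘ pi i = pi j.

Definition is_limit (J C : category) (D : functor J C) (L : C)
    (pi : forall j, L ~> D j) : Prop :=
  is_cone pi /\
  forall (T : C) (tau : forall j, T ~> D j), is_cone tau ->
    exists! h : T ~> L, forall j, pi j ∘ h = tau j.

Definition finitely_complete (C : category) : Prop :=
  forall (J : category) (D : functor J C), finite_category J ->
    exists (L : C) (pi : forall j, L ~> D j), is_limit pi.

(* A full subcategory of C is given by a predicate on the objects of C. *)
Definition closed_under_finite_limits (C : category) (P : C -> Prop) : Prop :=
  forall (J : category) (D : functor J C), finite_category J ->
    (forall j, P (D j)) ->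
    forall (L : C) (pi : forall j, L ~> D j), is_limit pi -> P L.

Section Notions.
Variable C : category.
Implicit Types A B X Y Z P T : C.

Definition is_terminal Z : Prop := forall X, exists! h : X ~> Z, True.
Definition is_initial Z : Prop := forall X, exists! h : Z ~> X, True.
Definition pointed : Prop := exists Z, is_initial Z /\ is_terminal Z.

Definition is_mono A B (m : A ~> B) : Prop :=
  forall T (u v : T ~> A), m ∘ u = m ∘ v -> u = v.

Definition is_iso A B (m : A ~> B) : Prop :=
  exists n : B ~> A, n ∘ m = idm A /\ m ∘ n = idm B.

Definition is_product A B P (p1 : P ~> A) (p2 : P ~> B) : Prop :=
  forall T (u : T ~> A) (v : T ~> B),
    exists! h : T ~> P, p1 ∘ h = u /\ p2 ∘ h = v.

Definition is_pullback A B Y P (f : A ~> Y) (g : B ~> Y)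
    (p1 : P ~> A) (p2 : P ~> B) : Prop :=
  f ∘ p1 = g ∘ p2 /\
  forall T (u : T ~> A) (v : T ~> B), f ∘ u = g ∘ v ->
    exists! h : T ~> P, p1 ∘ h = u /\ p2 ∘ h = v.

Definition jointly_strongly_epic A X Y (u : X ~> A) (v : Y ~> A) : Prop :=
  forall M (m : M ~> A), is_mono m ->
    (exists u' : X ~> M, m ∘ u' = u) -> (exists v' : Y ~> M, m ∘ v' = v) ->
    is_iso m.

Record point A Y := Point {
  epi : A ~> Y;
  sec : Y ~> A;
  epi_sec : epi ∘ sec = idm Y
}.

(* Limits are only determined up to isomorphism: the pullback P stands for
   A x_Y B, and the morphisms u = <1_A, tf> and v = <sg, 1_B> are given by
   their two components.  The same convention is used in [special]. *)
Definition maltsev_object Y : Prop :=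
  forall A B (a : point A Y) (b : point B Y)
         P (p1 : P ~> A) (p2 : P ~> B), is_pullback (epi a) (epi b) p1 p2 ->
  forall (u : A ~> P) (v : B ~> P),
    p1 ∘ u = idm A -> p2 ∘ u = sec b ∘ epi a ->
    p1 ∘ v = sec a ∘ epi b -> p2 ∘ v = idm B ->
    jointly_strongly_epic u v.

Definition point_class := forall A X, point A X -> Prop.

Definition maltsev_pullback_points : point_class := fun A X x =>
  exists A' X' (x' : point A' X') (r : point X X') (r' : point A A'),
    (maltsev_object A' /\ maltsev_object X') /\
    is_pullback (epi x') (epi r) (epi r') (epi x) /\
    epi r' ∘ sec x = sec x' ∘ epi r /\
    epi x ∘ sec r' = sec r ∘ epi x' /\
    sec r' ∘ sec x' = sec x ∘ sec r.

Definition special (S : point_class) X : Prop :=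
  forall P (p1 p2 : P ~> X), is_product p1 p2 ->
  forall d : point P X, epi d = p1 ->
    p1 ∘ sec d = idm X -> p2 ∘ sec d = idm X -> S P X d.

End Notions.

Arguments maltsev_object {C} Y.
Arguments maltsev_pullback_points {C} A X x.

(* Main.v *)
(** One inclusion takes the identity as the split epimorphism. Conversely, if
    [X * X -> X] is the pullback along [X -> X'] of a point [A' -> X'] of
    Mal'tsev objects, then the two have isomorphic kernels; the kernel of the
    first projection is [X], so [X] is a finite limit of Mal'tsev objects. *)

From Stdlib Require Import List.
Require Import Defs.

Set Implicit Arguments.
Unset Strict Implicit.
Unset Printing Implicit Defensive.

(** The shape whose limits are the terminal objects. *)
Definition empty_category : category.
Proof.
  refine (@Category Empty_set (fun _ _ => Empty_set) (fun a => a)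
            (fun a _ _ _ _ => match a with end) _ _ _);
    intros [].
Defined.

Lemma empty_category_finite : finite_category empty_category.
Proof. split; [exists nil | ]; intros []. Qed.

Definition empty_functor (C : category) : functor empty_category C.
Proof.
  refine (@Functor empty_category C (fun a => match a with end)
            (fun a => match a with end) _ _);
    intros [].
Defined.

Inductive cospan_ob := Lft | Rgt | Apex.

(** The shape [Lft] → [Apex] ← [Rgt], whose limits are pullbacks. Hom-types compute to [unit] or
    [Empty_set], so composition, the category laws and finiteness all reduce to case analysis on
    objects. *)
Definition cospan_hom (a b : cospan_ob) : Type :=
  match a, b with
  | Lft, Lft | Rgt, Rgt | _, Apex => unit
  | _, _ => Empty_set
  end.

Definition cospan_category : category.
Proof.
  refine (@Category cospan_ob cospan_hom
            (fun a => match a with Lft | Rgt | Apex => tt end)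
            (fun a b c =>
               match a, b, c return
                 cospan_hom b c -> cospan_hom a b -> cospan_hom a c with
               | Lft, Lft, Lft | Rgt, Rgt, Rgt => fun _ _ => tt
               | Lft, _, Apex | Rgt, _, Apex | Apex, _, Apex => fun _ _ => tt
               | Lft, Rgt, _ | Rgt, Lft, _ | Apex, Lft, _ | Apex, Rgt, _ =>
                   fun _ f => match f with end
               | _, Apex, Lft | _, Apex, Rgt | Lft, Lft, Rgt | Rgt, Rgt, Lft =>
                   fun g _ => match g with end
               end) _ _ _).
  - now intros [] [] [].
  - now intros [] [] [].
  - now intros [] [] [] [] [] [] [].
Defined.

Lemma cospan_category_finite : finite_category cospan_category.
Proof.
  split.
  - exists (Lft :: Rgt :: Apex :: nil). intros []; simpl; tauto.
  - intros [] []; (exists nil; now intros []) ||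
      (exists (tt :: nil); intros []; now left).
Qed.

Section Cospans.
Variables (C : category) (A B Y : C) (f : A ~> Y) (g : B ~> Y).

Definition cospan_fob (j : cospan_ob) : C :=
  match j with Lft => A | Rgt => B | Apex => Y end.

Definition cospan_functor : functor cospan_category C.
Proof.
  refine (@Functor cospan_category C cospan_fob
            (fun i j => match i, j return
                cospan_hom i j -> (cospan_fob i ~> cospan_fob j) with
              | Lft, Lft => fun _ => idm A
              | Rgt, Rgt => fun _ => idm B
              | Apex, Apex => fun _ => idm Y
              | Lft, Apex => fun _ => f
              | Rgt, Apex => fun _ => g
              | _, _ => fun e => match e with end
              end) _ _).
  - now intros [].
  - intros [] [] [] [] []; simpl; now rewrite ?comp1m, ?compm1.
Defined.

Definition cospan_cone P (p1 : P ~> A) (p2 : P ~> B) (j : cospan_ob) :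
    P ~> cospan_fob j :=
  match j with Lft => p1 | Rgt => p2 | Apex => f ∘ p1 end.

Lemma cospan_cone_is_cone P (p1 : P ~> A) (p2 : P ~> B) :
  f ∘ p1 = g ∘ p2 -> is_cone (D := cospan_functor) (cospan_cone p1 p2).
Proof. intros E [] [] []; simpl; now rewrite ?comp1m. Qed.

(** Closure of a subcategory is stated for limits of functors; this brings pullback squares into its
    scope. The leg at [Apex] is determined by the one at [Lft], so only the two outer legs carry
    data. *)
Lemma pullback_is_limit P (p1 : P ~> A) (p2 : P ~> B) :
  is_pullback f g p1 p2 ->
  is_limit (D := cospan_functor) (cospan_cone p1 p2).
Proof.
  intros [E U]; split; [now apply cospan_cone_is_cone | intros T tau Ht].
  pose proof (Ht Lft Apex tt : f ∘ tau Lft = tau Apex) as HL.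
  pose proof (Ht Rgt Apex tt : g ∘ tau Rgt = tau Apex) as HR.
  destruct (U T (tau Lft) (tau Rgt)) as [h [[h1 h2] hu]];
    [now rewrite HL, HR | ].
  exists h; split.
  - intros []; simpl; trivial.
    now rewrite <- compA, h1.
  - intros k Hk; apply hu; split; [exact (Hk Lft) | exact (Hk Rgt)].
Qed.

Lemma limit_is_pullback P (pi : forall j, P ~> cospan_functor j) :
  is_limit pi -> is_pullback f g (pi Lft) (pi Rgt).
Proof.
  intros [Hc U].
  pose proof (Hc Lft Apex tt : f ∘ pi Lft = pi Apex) as HL.
  pose proof (Hc Rgt Apex tt : g ∘ pi Rgt = pi Apex) as HR.
  split; [now rewrite HL, HR | intros T u v E].
  destruct (U T (cospan_cone u v)) as [h [Hh hu]];
    [now apply cospan_cone_is_cone | ].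
  exists h; split; [split; [exact (Hh Lft) | exact (Hh Rgt)] | ].
  intros k [k1 k2]; apply hu; intros []; simpl; trivial.
  now rewrite <- HL, <- compA, k1.
Qed.

Lemma pullback_exists : finitely_complete C ->
  exists P (p1 : P ~> A) (p2 : P ~> B), is_pullback f g p1 p2.
Proof.
  intros HC.
  destruct (HC _ cospan_functor cospan_category_finite) as [P [pi Hpi]].
  exists P, (pi Lft), (pi Rgt); now apply limit_is_pullback.
Qed.

Lemma closed_under_pullback (Q : C -> Prop) P (p1 : P ~> A) (p2 : P ~> B) :
  closed_under_finite_limits Q -> Q A -> Q B -> Q Y ->
  is_pullback f g p1 p2 -> Q P.
Proof.
  intros HQ HA HB HY Hp.
  apply (HQ _ cospan_functor cospan_category_finite) with
    (pi := cospan_cone p1 p2).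
  - now intros [].
  - now apply pullback_is_limit.
Qed.

End Cospans.

Section Terminal.
Variables (C : category) (Z : C) (Z_terminal : is_terminal Z).

Lemma terminal_hom_eq X (u v : X ~> Z) : u = v.
Proof.
  destruct (Z_terminal X) as [h [_ hu]].
  now rewrite <- (hu u I), <- (hu v I).
Qed.

Lemma closed_under_terminal (Q : C -> Prop) :
  closed_under_finite_limits Q -> Q Z.
Proof.
  intros HQ.
  apply (HQ _ (empty_functor C) empty_category_finite) with
    (pi := fun j : Empty_set => match j with end).
  - intros [].
  - split; [intros [] | intros T tau _].
    destruct (Z_terminal T) as [h [_ hu]].
    exists h; split; [intros [] | intros k _; now apply hu].
Qed.

(** Any two morphisms into [Z] agree, so commutation of a square over [Z] imposes no condition. *)
Lemma product_iff_pullback A B P (a : A ~> Z) (b : B ~> Z)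
    (p1 : P ~> A) (p2 : P ~> B) :
  is_product p1 p2 <-> is_pullback a b p1 p2.
Proof.
  split.
  - intros H; split; [apply terminal_hom_eq | intros T u v _; apply H].
  - intros [_ H] T u v; apply H, terminal_hom_eq.
Qed.

End Terminal.

Definition id_point (C : category) (X : C) : point X X :=
  Point (comp1m (idm X)).

Lemma is_pullback_id (C : category) (A X : C) (f : A ~> X) :
  is_pullback f (idm X) (idm A) f.
Proof.
  split; [now rewrite comp1m, compm1 | intros T u v E].
  rewrite comp1m in E.
  exists u; split; [split; [apply comp1m | exact E] | ].
  intros k [k1 _]; now rewrite comp1m in k1.
Qed.

(* Here [i = <0, 1>] is the kernel of the first projection, and a pullback
   square carries it to a kernel of [f']. *)
Lemma kernel_of_product_pullback (C : category) (Z X A' X' P : C)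
    (z : X ~> Z) (oX : Z ~> X) (oX' : Z ~> X')
    (p1 p2 : P ~> X) (f' : A' ~> X') (p : X ~> X') (r' : P ~> A')
    (i : X ~> P) :
  is_terminal Z -> is_initial Z -> is_product p1 p2 ->
  is_pullback f' p r' p1 ->
  p1 ∘ i = oX ∘ z -> p2 ∘ i = idm X ->
  is_pullback f' oX' (r' ∘ i) z.
Proof.
  intros Zt Zi HP [E U] i1 i2.
  (* Both sides start from the initial object. *)
  assert (Hp : p ∘ oX = oX').
  { destruct (Zi X') as [h [_ hu]].
    now rewrite <- (hu (p ∘ oX) I), <- (hu oX' I). }
  split; [now rewrite compA, E, <- compA, i1, compA, Hp | ].
  intros T u v Huv.
  assert (Hv : forall k : T ~> X, p1 ∘ (i ∘ k) = oX ∘ v).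
  { intros k; rewrite compA, i1, <- compA.
    f_equal; now apply terminal_hom_eq. }
  (* [h] is the lift of [u] to [P] whose first component is zero. *)
  destruct (U T u (oX ∘ v)) as [h [[h1 h2] hu]];
    [now rewrite compA, Hp | ].
  (* Having zero first component, [h] factors through the kernel [i]; the factor is its second
     component, since the two sides agree after both projections. Thus [p2 ∘ h] is the required
     mediating map. *)
  assert (Hh : i ∘ (p2 ∘ h) = h).
  { destruct (HP T (oX ∘ v) (p2 ∘ h)) as [k [_ ku]].
    transitivity k; [symmetry | ]; apply ku; split; trivial.
    now rewrite compA, i2, comp1m. }
  exists (p2 ∘ h); split.
  - split; [now rewrite <- compA, Hh | now apply terminal_hom_eq].
  - intros k [k1 _].
    (* [i ∘ k] solves the same lifting problem as [h], and [p2] recovers [k] from it. *)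
    rewrite (hu (i ∘ k)); [now rewrite compA, i2, comp1m | ].
    split; [now rewrite compA | apply Hv].
Qed.

Theorem proposition6p17 (C : category)
  (C_pointed : pointed C)
  (C_complete : finitely_complete C)
  (M_closed : closed_under_finite_limits (@maltsev_object C)) :
  forall X : C,
    maltsev_object X <-> special (@maltsev_pullback_points C) X.
Proof.
  destruct C_pointed as [Z [Zi Zt]]; intros X.
  pose proof (closed_under_terminal Zt M_closed) as MZ.
  destruct (Zt X) as [zX _].
  split.
  - intros MX P p1 p2 HP d Ed _ _.
    (* [P] is X × X, a pullback over the zero object, which is itself Mal'tsev. *)
    assert (MP : maltsev_object P).
    { apply (product_iff_pullback Zt zX zX) in HP.
      exact (closed_under_pullback M_closed MX MX MZ HP). }
    (* The point [d] already lies between Mal'tsev objects and is its own pullback along the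
       identity of [X]. *)
    exists P, X, d, (id_point X), (id_point P); simpl.
    rewrite !comp1m, !compm1.
    split; [now split | split; [apply is_pullback_id | now repeat split]].
  - intros HS.
    destruct (pullback_exists zX zX C_complete) as [P [p1 [p2 HP]]].
    apply (product_iff_pullback Zt zX zX) in HP.
    (* [s] is the diagonal, the section of the point to which speciality applies. *)
    destruct (HP X (idm X) (idm X)) as [s [[s1 s2] _]].
    destruct (HS P p1 p2 HP (Point s1) eq_refl s1 s2)
      as [A' [X' [x' [r [r' [[MA MX'] [Hpb _]]]]]]].
    destruct (Zi X) as [oX _], (Zi X') as [oX' _].
    destruct (HP X (oX ∘ zX) (idm X)) as [i [[i1 i2] _]].
    (* The kernel of [epi x'] is the pullback of [A'] and [Z] over [X'], three Mal'tsev objects, and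
       [X] is such a kernel via [r' ∘ i]. *)
    refine (closed_under_pullback M_closed MA MZ MX'
              (kernel_of_product_pullback oX' Zt Zi HP Hpb i1 i2)).
Qed.
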